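(* Let $p\ge 3$ be an odd integer and let $\lambda\ge\lambda_p$ be a real number. Then the map $f_{p,\lambda}\colon[0,1]\to[0,1]$ (constructed in the context) has topological entropy $h_{top}(f_{p,\lambda})=\log\lambda$.
   Context: For odd $p\ge 3$, $\lambda_p$ denotes the unique positive root of $X^p-2X^{p-2}-1$; one has $\lambda_p>\sqrt2>1$. $h_{top}$ denotes topological entropy. Construction of $f=f_{p,\lambda}$. Fix an odd integer $p\ge 3$ and a real $\lambda\ge\lambda_p$. Set $x_{p-1}:=1$, $x_{p-2}:=0$, $x_{p-3}:=\frac1\lambda$ and, for every integer $i$ with $0\le i\le p-4$ (no such $i$ if $p=3$), $$x_i:=\frac{(-1)^i}{\lambda^{p-i-2}}\sum_{j=0}^{p-i-3}(-\lambda)^j .$$ Set $$t:=1-\frac{x_0}{\lambda}=\frac{1}{\lambda^{p-1}}\Bigl(\lambda^{p-1}-\sum_{j=0}^{p-3}(-\lambda)^j\Bigr).$$ These points satisfy $x_{i+1}=1-\lambda x_i$ for $0\le i\le p-4$, $x_0=\lambda(1-t)$, and are ordered as $$0=x_{p-2}<x_{p-4}<\cdots<x_1<x_0<x_2<x_4<\cdots<x_{p-3}=\tfrac1\lambda\le t<x_{p-1}=1$$ (for $p=3$: $0=x_1<x_0=\frac1\lambda\le t<x_2=1$). Let $s:=x_{p-4}$ if $p\ge 5$ and $s:=1$ if $p=3$. The map $f\colon[0,1]\to[0,1]$ is the continuous map defined by: - $f(x):=1-\lambda x$ for $x\in[0,\frac1\lambda]$; - $f(x):=\lambda(x-t)$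 for $x\in[t,1]$; - if $t>\frac1\lambda$, put $\ell:=t-\frac1\lambda$, $k:=\lfloor\frac{\lambda\ell}{2s}\rfloor$, $J_i:=[\frac1\lambda+(i-1)\frac{2s}{\lambda},\frac1\lambda+i\frac{2s}{\lambda}]$ for $1\le i\le k$, and $K:=[\frac1\lambda+k\frac{2s}{\lambda},t]$ (possibly $k=0$, or $K=\{t\}$). On each $J=J_1,\ldots,J_k,K$, $f$ is the tent map that vanishes at both endpoints of $J$, is affine of slope $\lambda$ on the left half of $J$ and affine of slope $-\lambda$ on the right half of $J$ (so $f$ has maximum value $s$ on each $J_i$, and maximum value $<s$ on $K$). With this definition, $f(x_i)=x_{i+1}$ for $0\le i\le p-2$ and $f(x_{p-1})=x_0$. *)

(* Defs.v *)
From HB Require Import structures.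
From mathcomp Require Import all_boot all_order all_algebra finmap.
From mathcomp Require Import all_classical all_reals all_analysis.
From mathcomp Require Import ring lra zify.

Set Implicit Arguments.
Unset Strict Implicit.
Unset Printing Implicit Defensive.

Import Order.TTheory GRing.Theory Num.Theory.
Import numFieldNormedType.Exports.

Local Open Scope classical_set_scope.
Local Open Scope ring_scope.

(* Topological entropy of the restriction of [f] to a compact [f]-invariant set
   [K], by Bowen's (n, eps)-separated sets. *)
Section topological_entropy.
Context {R : realType} {T : pseudoMetricType R}.
Implicit Types (K : set T) (f : T -> T) (n : nat) (eps : R).

(* Distinct points of [E] are at distance at least [eps] for the metric
   d_n(x, y) = max_(k < n) d(f^k x, f^k y). *)
Definition separated f n eps (E : set T) :=
  forall x y, E x -> E y -> x <> y ->
    exists2 k, (k < n)%N & ~ ball (iter k f x) eps (iter k f y).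

Definition max_separated K f n eps : \bar R :=
  ereal_sup [set (#|` E|%fset%:R)%:E |
             E in [set E : {fset T} | [set` E] `<=` K /\ separated f n eps [set` E]]].

Definition entropy_at K f eps : \bar R :=
  limn_esup (fun n => (n%:R^-1)%:E * lne (max_separated K f n eps))%E.

Definition topological_entropy K f : \bar R :=
  lim (entropy_at K f eps @[eps --> 0^'+]).

End topological_entropy.

Section the_map.
Context {R : realType}.
Implicit Types (p i : nat) (l x a b : R).

Definition lambda_eq p x := x ^+ p - 2 * x ^+ (p - 2) - 1 = 0.

(* The positive root is unique, see [lambda_uniq]. *)
Definition lambda_ p : R := xget 0 [set x : R | 0 < x /\ lambda_eq p x].

(* The indices of the last clause are those with [i <= p - 4]. *)
Definition xpt p l i : R :=
  if (i == p - 1)%N then 1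
  else if (i == p - 2)%N then 0
  else if (i == p - 3)%N then l^-1
  else (-1) ^+ i / l ^+ (p - i - 2) * \sum_(j < p - i - 2) (- l) ^+ j.

Definition tpt p l : R := 1 - xpt p l 0 / l.

Definition spt p l : R := if (p == 3)%N then 1 else xpt p l (p - 4).

Definition num_full p l : nat := Num.truncn (l * (tpt p l - l^-1) / (2 * spt p l)).

(* [J_(i+1)] is the interval from [Jend p l i] to [Jend p l i.+1]. *)
Definition Jend p l i : R := l^-1 + i%:R * (2 * spt p l / l).

(* Slope [l] on the left half of the interval from [a] to [b], slope [- l] on
   the right half, zero at [a] and [b]. *)
Definition tent l a b x : R := l * Num.min (x - a) (b - x).

(* Only the values on [0, 1] are meaningful. In the last clause, [i] is the
   number of endpoints [Jend p l 1], [Jend p l 2], ... that are at most [x]. *)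
Definition f_pl p l x : R :=
  if x <= l^-1 then 1 - l * x
  else if tpt p l <= x then l * (x - tpt p l)
  else let i := Num.truncn (l * (x - l^-1) / (2 * spt p l)) in
       if (i < num_full p l)%N then tent l (Jend p l i) (Jend p l i.+1) x
       else tent l (Jend p l (num_full p l)) (tpt p l) x.

Lemma lambda_eqE n x : lambda_eq n.+3 x <-> x ^+ n.+1 * (x ^+ 2 - 2) = 1.
Proof.
rewrite /lambda_eq !subSS subn0 (_ : x ^+ n.+3 = x ^+ n.+1 * x ^+ 2); last first.
  by rewrite -exprD addn2.
by split=> h; lra.
Qed.

Lemma lambda_eq_gt n x : 0 < x -> lambda_eq n.+3 x -> 2 < x ^+ 2.
Proof.
move=> x0 /lambda_eqE h; rewrite -subr_gt0 -(pmulr_rgt0 _ (exprn_gt0 n.+1 x0)).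
by rewrite h.
Qed.

Lemma lambda_eq_le n x y : 0 < x -> lambda_eq n.+3 x -> x <= y ->
  1 <= y ^+ n.+1 * (y ^+ 2 - 2).
Proof.
move=> x0 h xy; have x2 := lambda_eq_gt x0 h; move/lambda_eqE: h => {1}<-.
have y0 : 0 <= y by lra.
apply: ler_pM.
- by rewrite exprn_ge0 // ltW.
- by rewrite subr_ge0 ltW.
- by rewrite lerXn2r // nnegrE ltW.
- by rewrite lerD2r lerXn2r // nnegrE ltW.
Qed.

Lemma lambda_uniq p x y : (3 <= p)%N -> 0 < x -> 0 < y ->
  lambda_eq p x -> lambda_eq p y -> x = y.
Proof.
case: p => [|[|[|n]]] // _.
wlog xy : x y / x <= y => [wl x0 y0 hx hy|x0 y0 hx hy].
  by case: (leP x y) => [/wl|/ltW/wl/(_ y0 x0 hy hx)] ->.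
apply/eqP; rewrite eq_le xy leNgt; apply/negP => {}xy.
have x2 := lambda_eq_gt x0 hx.
have : x ^+ n.+1 * (x ^+ 2 - 2) < y ^+ n.+1 * (y ^+ 2 - 2).
  by apply: ltr_pM; rewrite ?exprn_ge0 ?ltrD2r ?ltrXn2r ?subr_ge0 // ltW.
by move/lambda_eqE: hx => ->; move/lambda_eqE: hy => ->; rewrite ltxx.
Qed.

Lemma lambda_P p : (3 <= p)%N -> 0 < lambda_ p /\ lambda_eq p (lambda_ p).
Proof.
case: p => [|[|[|n]]] // _.
have [x [x0 hx]] : exists x : R, 0 < x /\ lambda_eq n.+3 x.
  pose P : {poly R} := 'X ^+ n.+1 * ('X ^+ 2 - 2%:P) - 1%:P.
  have PE y : P.[y] = y ^+ n.+1 * (y ^+ 2 - 2) - 1.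
    by rewrite /P !hornerE.
  have [||x /andP[x1 _] /rootP] := @poly_ivt R P 1 2.
  - by lra.
  - rewrite !PE expr1n; apply/andP; split; first by lra.
    rewrite subr_ge0; apply: mulr_ege1; first by apply: exprn_ege1; lra.
    by rewrite expr2; lra.
  - rewrite PE => /eqP; rewrite subr_eq0 => /eqP h; exists x.
    by split; [exact: lt_le_trans ltr01 x1 | exact/lambda_eqE].
by rewrite /lambda_; apply: (@xgetPex _ 0 [set x | 0 < x /\ lambda_eq n.+3 x]); exists x.
Qed.

Lemma geo_sum l m : (1 + l) * \sum_(j < m) (- l) ^+ j = 1 - (- l) ^+ m.
Proof.
elim: m => [|m ih]; first by rewrite big_ord0 expr0; ring.
by rewrite big_ord_recr /= mulrDr ih exprS; ring.
Qed.

Section unit_interval.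
Variables (p : nat) (l : R).
Hypotheses (hp : (3 <= p)%N) (podd : odd p) (hl : lambda_ p <= l).

Lemma lambda_gt1 : 1 < l.
Proof.
have [] := lambda_P hp; move: hl; case: p hp => [|[|[|n]]] // _ le0 g0 h.
have := lambda_eq_gt g0 h; rewrite expr2; nra.
Qed.

Lemma xpt0E : xpt p l 0 = (1 + l ^+ (p - 2)) / ((1 + l) * l ^+ (p - 2)).
Proof.
have l1 := lambda_gt1; case: p hp podd => [|[|[|n]]] // _; rewrite /= !negbK => en.
have l0 : l ^+ n.+1 != 0 by rewrite expf_neq0; lra.
have lS : 1 + l != 0 by lra.
rewrite /xpt !subSS !subn0 /=; case: ifP => [/eqP n0|_].
  by rewrite -n0 expr1; field; apply/andP; split; lra.
apply: (mulfI lS); rewrite expr0 mulrCA geo_sum exprNn -(signr_odd _ n.+1) /= en expr1.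
by field; rewrite l0 lS.
Qed.

Lemma xpt0_itv : 0 < xpt p l 0 <= 1.
Proof.
have l1 := lambda_gt1; rewrite xpt0E.
have L1 : 1 <= l ^+ (p - 2) by apply: exprn_ege1; lra.
by rewrite divr_gt0 ?mulr_gt0 ?addr_gt0 //= ?ler_pdivrMr ?mulr_gt0 ?addr_gt0 ?ltr01 //; nra.
Qed.

Lemma tpt_itv : l^-1 <= tpt p l <= 1.
Proof.
have l1 := lambda_gt1; have l0 : 0 < l by lra.
have /andP[x0 x1] := xpt0_itv.
rewrite /tpt; apply/andP; split; last by rewrite lerBlDr lerDl divr_ge0 // ltW.
rewrite -(ler_pM2l l0) mulfV ?gt_eqF // mulrBr mulr1 mulrCA divff ?gt_eqF // mulr1.
rewrite xpt0E; case: p hp hl => [|[|[|n]]] // h3 hln; rewrite !subSS subn0.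
have [g0 /(lambda_eq_le g0)/(_ hln)] := lambda_P h3.
have : 0 < l ^+ n.+1 by rewrite exprn_gt0.
set L := l ^+ n.+1 => L0 hL.
suff : (1 + L) / ((1 + l) * L) <= l - 1 by lra.
by rewrite ler_pdivrMr ?mulr_gt0 ?addr_gt0 //; lra.
Qed.

Lemma spt_itv : 0 < spt p l <= 1.
Proof.
have l1 := lambda_gt1; rewrite /spt; case: p hp podd => [|[|[|[|n]]]] // _.
  by rewrite ltr01 lexx.
rewrite /= !negbK => en; rewrite /xpt !subSS subn0.
have -> : (n == n.+3) = false by lia.
have -> : (n == n.+2) = false by lia.
have -> : (n == n.+1) = false by lia.
have -> : (n.+4 - n - 2 = 2)%N by lia.
rewrite !big_ord_recl big_ord0 /= expr0 addr0 -(signr_odd _ n) /= en (expr1 (-1)) mulN1r.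
have -> : - (l ^+ 2)^-1 * (1 + (- l) ^+ 1) = (l - 1) / l ^+ 2 by rewrite expr1; ring.
by rewrite divr_gt0 ?exprn_gt0 ?subr_gt0 ?ler_pdivrMr ?exprn_gt0 // ?expr2 //; nra.
Qed.

Lemma tent_itv a b x : a <= x <= b -> 0 <= tent l a b x <= l * (b - a) / 2.
Proof.
have l1 := lambda_gt1 => /andP[ax xb]; rewrite /tent.
have l0 : 0 <= l by lra.
by case: (leP (x - a) (b - x)) => h; rewrite -[_ / 2]mulrA mulr_ge0 ?ler_wpM2l //; lra.
Qed.

Lemma le_Jend i x : (Jend p l i <= x) = (i%:R <= l * (x - l^-1) / (2 * spt p l)).
Proof.
have l1 := lambda_gt1; have /andP[s0 _] := spt_itv.
rewrite /Jend -lerBrDl ler_pdivlMr ?mulr_gt0 // mulrA.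
by rewrite ler_pdivrMr 1?mulrC //; lra.
Qed.

Lemma f_pl_left x : x <= l^-1 -> f_pl p l x = 1 - l * x.
Proof. by rewrite /f_pl => ->. Qed.

Lemma f_pl_right x : tpt p l <= x -> f_pl p l x = l * (x - tpt p l).
Proof.
move=> tx; rewrite /f_pl tx; case: ifP => // xl.
have l1 := lambda_gt1; have /andP[lt _] := tpt_itv.
have xE : x = l^-1 by apply/eqP; rewrite eq_le xl (le_trans lt).
have tE : tpt p l = l^-1 by apply/eqP; rewrite eq_le lt -xE tx.
by rewrite xE tE divff ?gt_eqF ?subrr ?mulr0 //; lra.
Qed.

Lemma Jend_num_full : Jend p l (num_full p l) <= tpt p l.
Proof.
have /andP[s0 _] := spt_itv; have l1 := lambda_gt1; have /andP[lt _] := tpt_itv.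
by rewrite le_Jend truncn_le // divr_ge0 // mulr_ge0 //; lra.
Qed.

Lemma Jend0 : Jend p l 0 = l^-1. Proof. by rewrite /Jend mul0r addr0. Qed.

Lemma JendS i : Jend p l i.+1 = Jend p l i + 2 * spt p l / l.
Proof. by rewrite /Jend -natr1; ring. Qed.

Lemma Jend_le i j : (i <= j)%N -> Jend p l i <= Jend p l j.
Proof.
have /andP[s0 _] := spt_itv; have l1 := lambda_gt1 => ij.
by rewrite /Jend lerD2l ler_wpM2r ?ler_nat // divr_ge0; lra.
Qed.

Lemma f_pl_J i x : (i < num_full p l)%N -> Jend p l i <= x <= Jend p l i.+1 ->
  f_pl p l x = tent l (Jend p l i) (Jend p l i.+1) x.
Proof.
move=> ik /andP[ix xi]; have l1 := lambda_gt1; have /andP[s0 _] := spt_itv.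
have l0 : l != 0 by lra.
have tent_l a b : a <= b -> tent l a b a = 0.
  by move=> ab; rewrite /tent subrr min_l ?mulr0 // subr_ge0.
have tent_r a b : a <= b -> tent l a b b = 0.
  by move=> ab; rewrite /tent subrr min_r ?mulr0 // subr_ge0.
have kt := Jend_num_full; have ii := Jend_le (leqnSn i).
have lx : l^-1 <= x by rewrite -Jend0 (le_trans _ ix) // Jend_le.
case: (leP x l^-1) => [xl|ltx].
  have xE : x = l^-1 by apply/eqP; rewrite eq_le xl lx.
  have xi' : x = Jend p l i.
    by apply/eqP; rewrite eq_le ix xE -Jend0 Jend_le.
  by rewrite f_pl_left // {2}xi' tent_l // xE divff ?subrr.
case: (leP (tpt p l) x) => [tx|xt].
  have xt : x <= tpt p l by rewrite (le_trans xi) // (le_trans _ kt) // Jend_le.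
  have xE : x = Jend p l i.+1.
    by apply/eqP; rewrite eq_le xi (le_trans _ tx) // (le_trans _ kt) // Jend_le.
  rewrite f_pl_right // {2}xE tent_r //.
  have -> : x = tpt p l by apply/eqP; rewrite eq_le xt tx.
  by rewrite subrr mulr0.
rewrite /f_pl leNgt ltx leNgt xt /=.
have y0 : 0 <= l * (x - l^-1) / (2 * spt p l).
  by rewrite divr_ge0 // mulr_ge0 //; lra.
move: (truncn_itv y0) => /andP[]; set j := Num.truncn _.
rewrite -le_Jend ltNge -le_Jend -ltNge => jx xj.
have ij : (i <= j)%N.
  by rewrite leqNgt; apply/negP => /Jend_le ji; have := lt_le_trans xj ji; rewrite ltNge ix.
case: (ltngtP i j) ij => // [ij|<-] _; last by rewrite ik.
have xE : x = Jend p l i.+1.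
  by apply/eqP; rewrite eq_le xi (le_trans _ jx) // Jend_le.
have jE : x = Jend p l j by apply/eqP; rewrite eq_le jx xE Jend_le.
rewrite {3}xE tent_r //; case: ifP => jk; first by rewrite jE tent_l ?Jend_le.
have -> : x = Jend p l (num_full p l); last by rewrite tent_l.
apply/eqP; rewrite eq_le {1}xE Jend_le //= jE Jend_le //.
by rewrite leqNgt jk.
Qed.

Lemma f_pl_K x : l^-1 < tpt p l -> Jend p l (num_full p l) <= x <= tpt p l ->
  f_pl p l x = tent l (Jend p l (num_full p l)) (tpt p l) x.
Proof.
move=> lt /andP[kx xt]; have l1 := lambda_gt1; have /andP[s0 _] := spt_itv.
have l0 : l != 0 by lra.
have kt := Jend_num_full.
have lk : l^-1 <= Jend p l (num_full p l) by rewrite -Jend0 Jend_le.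
case: (leP x l^-1) => [xl|ltx].
  have xE : x = l^-1 by apply/eqP; rewrite eq_le xl (le_trans lk).
  have kE : Jend p l (num_full p l) = l^-1.
    by apply/eqP; rewrite eq_le lk -xE kx.
  rewrite f_pl_left // kE xE /tent subrr min_l ?mulr0 ?divff ?subrr //.
  by rewrite subr_ge0 ltW.
case: (leP (tpt p l) x) => [tx|{}xt].
  have -> : x = tpt p l by apply/eqP; rewrite eq_le xt tx.
  by rewrite f_pl_right // /tent subrr min_r ?mulr0 // subr_ge0.
rewrite /f_pl leNgt ltx leNgt xt /=.
have y0 : 0 <= l * (x - l^-1) / (2 * spt p l).
  by rewrite divr_ge0 // mulr_ge0 //; lra.
case: ifP => //; rewrite ltnNge => /negP[].
by rewrite (truncn_ge_nat _ y0) -le_Jend.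
Qed.

Lemma Jend_num_fullS : tpt p l < Jend p l (num_full p l).+1.
Proof.
rewrite ltNge le_Jend -ltNge; have l1 := lambda_gt1; have /andP[lt _] := tpt_itv.
have /andP[s0 _] := spt_itv.
have y0 : 0 <= l * (tpt p l - l^-1) / (2 * spt p l).
  by rewrite divr_ge0 // mulr_ge0 //; lra.
by have /andP[] := truncn_itv y0.
Qed.

Lemma f_pl_itv x : 0 <= x <= 1 -> 0 <= f_pl p l x <= 1.
Proof.
move=> /andP[x0 x1]; have l1 := lambda_gt1; have /andP[s0 s1] := spt_itv.
have l0 : 0 < l by lra.
have ln0 : l != 0 by lra.
have /andP[_ u1] := xpt0_itv.
case: (leP x l^-1) => [xl|lx].
  have : l * x <= 1 by rewrite mulrC -ler_pdivlMr // div1r.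
  by rewrite f_pl_left //; nra.
case: (leP (tpt p l) x) => [tx|xt].
  rewrite f_pl_right //; apply/andP; split; first by nra.
  rewrite (le_trans _ u1) // (_ : xpt p l 0 = l * (1 - tpt p l)); first by nra.
  by rewrite /tpt; field.
have tent1 a b : b - a <= 2 * spt p l / l -> a <= x <= b -> 0 <= tent l a b x <= 1.
  rewrite ler_pdivlMr // => ab /tent_itv/andP[-> /= h].
  by rewrite (le_trans h) // (le_trans _ s1) // ler_pdivrMr //; lra.
rewrite /f_pl (leNgt x) lx (leNgt (tpt p l)) xt /=.
have y0 : 0 <= l * (x - l^-1) / (2 * spt p l).
  by rewrite divr_ge0 // mulr_ge0 //; lra.
move: (truncn_itv y0) => /andP[]; set j := Num.truncn _.
rewrite -le_Jend ltNge -le_Jend -ltNge => jx xj.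
case: ltnP => jk; apply: tent1.
- by rewrite JendS addrC addKr.
- by rewrite jx ltW.
- by rewrite lerBlDl -JendS ltW // Jend_num_fullS.
- by rewrite (le_trans _ jx) ?Jend_le ?ltW.
Qed.

End unit_interval.

End the_map.

(* Main.v *)
(* The map has slope l or - l on either side of every point, hence so does every
   iterate with slopes l^m and - l^m; compactness makes this uniform.
   Upper bound: f is l-Lipschitz at small scales, so (n, eps)-separated points
   are at distance at least eps / l^n.
   Lower bound: for g = f^m and e small, every ball of radius e is cut by one
   point into two pieces on which g multiplies distances by l^m, so a Bowen ball
   of order n for g contains at most 2^n points of a grid of step e / l^(mn).
   A maximal separated subset of the grid thus has at least about (l^m / 2)^n
   points, and the entropy is at least ln l - ln 2 / m for every m. *)
Require Import Defs.
From mathcomp Require Import all_boot all_order all_algebra finmap.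
From mathcomp Require Import all_classical all_reals all_analysis.
From mathcomp Require Import ring lra zify.

Set Implicit Arguments.
Unset Strict Implicit.
Unset Printing Implicit Defensive.

Import Order.TTheory GRing.Theory Num.Theory.
Import numFieldNormedType.Exports.

Local Open Scope classical_set_scope.
Local Open Scope ring_scope.

(** Greedy choice: keep [x], discard its at most [K] neighbours (itself among them), and continue
    with the rest. This will thin a grid to a set separated in the Bowen metric. *)
Lemma exists_net (T : eqType) (c : rel T) (K : nat) (s : seq T) :
  reflexive c -> symmetric c -> uniq s ->
  (forall x, x \in s -> (count (c x) s <= K)%N) ->
  exists t : seq T, [/\ uniq t, {subset t <= s},
    {in t &, forall x y, x != y -> ~~ c x y} & (size s <= K * size t)%N].
Proof.
move=> crefl csym; have [n] := ubnP (size s); elim: n s => // n IH [|x s] /= sn.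
  by move=> _ _; exists [::].
move=> /andP[xs us] cK.
pose r := [seq y <- s | ~~ c x y].
have [||y|t [ut tr tc rt]] := IH r.
- by rewrite (leq_ltn_trans _ (sn : (size s < n)%N)) // size_filter count_size.
- exact: filter_uniq.
- rewrite mem_filter => /andP[_ ys].
  apply: leq_trans (cK y _); last by rewrite inE ys orbT.
  rewrite count_filter (leq_trans _ (leq_addl _ _)) //.
  by apply: sub_count => z /andP[].
exists (x :: t); split.
- rewrite /= ut andbT; apply/negP => /tr.
  by rewrite mem_filter crefl.
- move=> y; rewrite !inE => /orP[->//|/tr].
  by rewrite mem_filter => /andP[_ ->]; rewrite orbT.
- move=> y z; rewrite !inE => /orP[/eqP->|yt] /orP[/eqP->|zt].
  + by rewrite eqxx.
  + by move=> _; have := tr _ zt; rewrite mem_filter => /andP[].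
  + by move=> _; have := tr _ yt; rewrite mem_filter csym => /andP[].
  + exact: tc.
- have := cK x; rewrite inE eqxx => /(_ isT); rewrite crefl => cx.
  have : (count (c x) s + size r = size s)%N by rewrite size_filter count_predC.
  by rewrite /= mulnS; lia.
Qed.

(** * One-sided slopes, their uniformity, and counting of separated points *)

Section constant_slope.
Context {R : realType}.
Implicit Types (f g : R -> R) (L M x e d : R).

(* [b = true] is the left side of [x]; [c = true] means that [g] decreases when
   moving away from [x]. *)
Definition affine_sides g L x := forall b : bool,
  exists2 e, 0 < e & exists c : bool, forall u, 0 <= u < e ->
    0 <= x + (-1) ^+ b * u <= 1 ->
    g (x + (-1) ^+ b * u) = g x + (-1) ^+ c * (L * u).

(** The boolean [c] plays two roles: it is the sign with which [g] leaves [g x], and therefore also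
    the side of [g x] on which [f] has to be followed, whence [fx c]. *)
Lemma affine_sides_comp f g L M x : 0 < L ->
  (forall y, 0 <= y <= 1 -> 0 <= g y <= 1) ->
  affine_sides g L x -> affine_sides f M (g x) -> affine_sides (f \o g) (M * L) x.
Proof.
move=> L0 gI gx fx b; have [e e0 [c gE]] := gx b.
have [e' e'0 [c' fE]] := fx c.
exists (Num.min e (e' / L)); first by rewrite lt_min e0 divr_gt0.
exists c' => u; rewrite lt_min => /and3P[u0 ue ue'] xu.
have gxu : g (x + (-1) ^+ b * u) = g x + (-1) ^+ c * (L * u).
  by apply: gE; rewrite ?u0.
rewrite /= gxu fE ?mulrA // -?mulrA; last by rewrite -gxu; exact: gI.
by rewrite (mulr_ge0 (ltW L0) u0) /= mulrC -ltr_pdivlMr.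
Qed.

Lemma affine_sides_iter f L : 0 < L ->
  (forall y, 0 <= y <= 1 -> 0 <= f y <= 1) ->
  (forall y, 0 <= y <= 1 -> affine_sides f L y) ->
  forall n x, 0 <= x <= 1 ->
    0 <= iter n f x <= 1 /\ affine_sides (iter n f) (L ^+ n) x.
Proof.
move=> L0 fI fL; elim=> [|n IH] x xI.
  by split=> // b; exists 1 => //; exists b => u _ _; rewrite expr0 mul1r.
split; first by apply: fI; have [] := IH x xI.
rewrite exprS; have [fx afx] := IH x xI.
apply: affine_sides_comp (fL _ fx); rewrite ?exprn_gt0 // => y /IH[//].
Qed.

(* The boolean equation says that [a] and [b] are on the same side of [z]. *)
Definition two_laps g L e x := exists z : R, forall a b : R,
  0 <= a <= 1 -> 0 <= b <= 1 -> `|a - x| < e -> `|b - x| < e ->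
  `|g a - g b| <= L * `|a - b| /\
  ((a <= z) = (b <= z) -> `|g a - g b| = L * `|a - b|).

Lemma affine_sides_two_laps g L x : 0 <= L -> affine_sides g L x ->
  exists2 e, 0 < e & two_laps g L e x.
Proof.
move=> L0 gx; have [e1 e10 [c gr]] := gx false; have [e2 e20 [d gl]] := gx true.
exists (Num.min e1 e2); first by rewrite lt_min e10.
(* The cut is [x] itself. On one side the affine formula gives equality; for points on opposite
   sides the triangle inequality through [g x] gives the upper bound. *)
exists x.
have {}gr a : 0 <= a <= 1 -> x <= a -> `|a - x| < e1 ->
    g a = g x + (-1) ^+ c * (L * (a - x)).
  move=> aI xa; rewrite ger0_norm ?subr_ge0 // => ae.
  by have := gr (a - x); rewrite expr0 mul1r [x + _]addrC subrK; apply;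
    rewrite ?subr_ge0 ?xa.
have {}gl a : 0 <= a <= 1 -> a <= x -> `|a - x| < e2 ->
    g a = g x + (-1) ^+ d * (L * (x - a)).
  move=> aI xa; rewrite distrC ger0_norm ?subr_ge0 // => ae.
  have := gl (x - a); rewrite expr1 mulN1r opprB [x + (a - x)]addrC subrK.
  by apply; rewrite ?subr_ge0 ?xa.
have sgn (k : bool) y : `|(-1) ^+ k * (L * y)| = L * `|y|.
  by rewrite normrM normr_sign mul1r normrM ger0_norm.
have rr a b : 0 <= a <= 1 -> 0 <= b <= 1 -> `|a - x| < e1 -> `|b - x| < e1 ->
    x <= a -> x <= b -> `|g a - g b| = L * `|a - b|.
  move=> aI bI ae be xa xb; rewrite (gr a) ?(gr b) // -(sgn c).
  by congr `| _ |; ring.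
have ll a b : 0 <= a <= 1 -> 0 <= b <= 1 -> `|a - x| < e2 -> `|b - x| < e2 ->
    a <= x -> b <= x -> `|g a - g b| = L * `|a - b|.
  move=> aI bI ae be xa xb; rewrite (gl a) ?(gl b) // -(sgn d) -normrN.
  by congr `| _ |; ring.
have lr a b : 0 <= a <= 1 -> 0 <= b <= 1 -> `|a - x| < e2 -> `|b - x| < e1 ->
    a <= x -> x <= b -> `|g a - g b| <= L * `|a - b|.
  move=> aI bI ae be xa xb; rewrite (gl a) ?(gr b) //.
  rewrite [X in `|X|](_ : _ =
    (-1) ^+ d * (L * (x - a)) - (-1) ^+ c * (L * (b - x))); last by ring.
  rewrite (le_trans (ler_normB _ _)) // !sgn -mulrDr ler_wpM2l //.
  by rewrite (distrC a b) !ger0_norm ?subr_ge0 ?(le_trans xa) //; lra.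
move=> a b aI bI; rewrite !lt_min => /andP[a1 a2] /andP[b1 b2].
case: (leP a x) => ax; case: (leP b x) => bx; split => //.
- by rewrite ll.
- by move=> _; exact: ll.
- by apply: lr => //; exact: ltW.
- by rewrite distrC (distrC a); apply: lr => //; exact: ltW.
- by rewrite rr // ltW.
- by move=> _; apply: rr => //; exact: ltW.
Qed.

(** A ball of radius less than [e / 2] around a point [x'] with [|x' - x| < e / 2] lies in the
    [e]-ball of [x], so the cut of [x] serves [x'] too; this is why [two_laps] does not tie [z] to
    the centre. Compactness of the interval then yields a common radius. *)
Lemma two_laps_unif g L : 0 <= L ->
  (forall x, 0 <= x <= 1 -> affine_sides g L x) ->
  exists2 e, 0 < e & forall x, 0 <= x <= 1 -> two_laps g L e x.
Proof.
move=> L0 gL; have /compact_near_coveringP/(_ _ (0 : R)^'+ (two_laps g L)) :=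
  @segment_compact R 0 1.
have H : forall x, `[0, 1]%classic x ->
    \forall x' \near x & i \near (0 : R)^'+, two_laps g L i x'.
  move=> x /=; rewrite in_itv /= => xI.
  have [e e0 [z ze]] := affine_sides_two_laps L0 (gL x xI).
  have e2 : 0 < e / 2 by rewrite divr_gt0.
  exists (ball x (e / 2), [set i | i < e / 2]).
    by split; [exact: nbhsx_ballx | exact: nbhs_right_lt].
  move=> [x' i] /= [xx' ie]; exists z => a b aI bI ai bi.
  apply: ze => //.
    rewrite (le_lt_trans (ler_distD x' _ _)) // (splitr e) ltrD ?(lt_trans ai) //.
    by rewrite distrC.
  rewrite (le_lt_trans (ler_distD x' _ _)) // (splitr e) ltrD ?(lt_trans bi) //.
  by rewrite distrC.
move=> /(_ _ H) U.
have /filter_ex[e [e0 eU]] :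
    \forall e \near (0 : R)^'+, 0 < e /\ `[0, 1]%classic `<=` two_laps g L e.
  by apply: filterI => //; exact: nbhs_right_gt.
exists e => // x xI; by apply: eU; rewrite /= in_itv.
Qed.

Lemma bowen_ball_count g L e : 0 < L -> 0 < e ->
  (forall x, 0 <= x <= 1 -> 0 <= g x <= 1) ->
  (forall x, 0 <= x <= 1 -> two_laps g L e x) ->
  forall n d (s : seq R), 0 < d -> e <= L ^+ n * d -> uniq s ->
  {in s, forall x, 0 <= x <= 1} ->
  {in s &, forall x y, x != y -> d <= `|x - y|} ->
  (forall k, (k <= n)%N -> {in s &, forall x y, `|iter k g x - iter k g y| < e}) ->
  (size s <= 2 ^ n)%N.
Proof.
move=> L0 e0 gI glap; elim=> [|n IH] d s d0 ed us sI sd sB.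
  (* For [n = 0] the spacing [d] is at least [e], while any two points are less than [e] apart:
     there is at most one point. *)
  case: s us sI sd sB => [|x [|y s]] //= /andP[xs _] _ sd sB.
  have xy : x != y by apply: contraNneq xs => ->; rewrite inE eqxx.
  have := sd x y; rewrite !inE !eqxx !orbT => /(_ isT isT xy).
  have := sB 0%N isT x y; rewrite !inE !eqxx !orbT => /(_ isT isT) /=.
  by move=> h /le_lt_trans/(_ h); rewrite -[d]mul1r -(expr0 L) ltNge ed.
case: s us sI sd sB => [//|x s]; set r := x :: s => us sI sd sB.
(* Any member can be the centre: closeness at time 0 puts all the others within [e] of it. *)
have xr : x \in r by rewrite inE eqxx.
have [z zP] := glap x (sI _ xr).
have half (t : bool) : (count (fun a : R => (a <= z)%R == t) r <= 2 ^ n)%N.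
  pose q := [seq a <- r | (a <= z) == t].
  have qr a : a \in q -> [/\ a \in r, 0 <= a <= 1, (a <= z) = t & `|a - x| < e].
    rewrite mem_filter => /andP[/eqP az ar]; split=> //; first exact: sI.
    exact: (sB 0%N).
  have gE a b : a \in q -> b \in q -> `|g a - g b| = L * `|a - b|.
    move=> /qr[ar aI az ax] /qr[br bI bz bx].
    by have [_] := zP a b aI bI ax bx; apply; rewrite az bz.
  (* On one side of [z] the map [g] is injective and stretches by [L], so the image has spacing
     [L * d], and [L ^+ n * (L * d)] is the old [L ^+ n.+1 * d]. Time [k] of the image is time
     [k.+1] of the original. *)
  rewrite -size_filter -/q -(size_map g); apply: (IH (L * d)).
  - by rewrite mulr_gt0.
  - by rewrite mulrA -exprSr.
  - rewrite map_inj_in_uniq ?filter_uniq // => a b aq bq gab.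
    have := gE a b aq bq; rewrite gab subrr normr0 => /esym/eqP.
    by rewrite mulf_eq0 gt_eqF //= normr_eq0 subr_eq0 => /eqP.
  - by move=> _ /mapP[a /qr[_ aI _ _] ->]; exact: gI.
  - move=> _ _ /mapP[a aq ->] /mapP[b bq ->] gab.
    rewrite gE // ler_pM2l //; have [ar _ _ _] := qr a aq; have [br _ _ _] := qr b bq.
    by apply: sd => //; apply: contraNneq gab => ->.
  - move=> k kn _ _ /mapP[a /qr[ar _ _ _] ->] /mapP[b /qr[br _ _ _] ->].
    by rewrite -!iterSr; apply: sB.
rewrite -(count_predC (fun a : R => (a <= z) == true)) expnS mul2n -addnn leq_add //.
apply: leq_trans (half false); apply: sub_count => a /=.
by case: (a <= z).
Qed.

Lemma separated_seq g L e n : 0 < L -> 0 < e ->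
  (forall x, 0 <= x <= 1 -> 0 <= g x <= 1) ->
  (forall x, 0 <= x <= 1 -> two_laps g L e x) ->
  exists t : seq R, [/\ uniq t, {in t, forall x, 0 <= x <= 1},
    {in t &, forall x y, x != y ->
      exists2 k, (k <= n)%N & e / 2 <= `|iter k g x - iter k g y|} &
    L ^+ n / e <= (2 ^ n * size t)%:R].
Proof.
(* [N] is the integer part of [1 / d], so the [N.+1] grid points [i * d] stay in the unit interval
   and number more than [L ^+ n / e]. *)
move=> L0 e0 gI glap; pose N := Num.truncn (L ^+ n / e); pose d := e / L ^+ n.
have d0 : 0 < d by rewrite divr_gt0 ?exprn_gt0.
have Le0 : 0 <= L ^+ n / e by rewrite divr_ge0 ?exprn_ge0 ?ltW.
pose s : seq R := [seq i%:R * d | i <- iota 0 N.+1].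
have sd : {in s &, forall x y, x != y -> d <= `|x - y|}.
  move=> _ _ /mapP[i _ ->] /mapP[j _ ->] ij.
  rewrite -mulrBl normrM (gtr0_norm d0) ler_peMl ?(ltW d0) //.
  have {}ij : i != j by apply: contraNneq ij => ->.
  wlog lij : i j ij / (i < j)%N => [wl|].
    case: (ltngtP i j) (ij) => [lij|lij|//].
    - by move=> _; exact: wl.
    - by move=> _; rewrite distrC; apply: wl; rewrite // eq_sym.
  by rewrite distrC -natrB ?(ltnW lij) // normr_nat ler1n subn_gt0.
have sI : {in s, forall x, 0 <= x <= 1}.
  move=> _ /mapP[i + ->]; rewrite mem_iota add0n ltnS => iN.
  apply/andP; split; first by rewrite mulr_ge0 // ltW.
  rewrite -ler_pdivlMr // div1r /d invf_div.
  have : N%:R <= L ^+ n / e by rewrite truncn_le.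
  by apply: le_trans; rewrite ler_nat; case/andP: iN.
have us : uniq s.
  rewrite map_inj_uniq ?iota_uniq // => i j /(mulIf (lt0r_neq0 d0))/eqP.
  by rewrite eqr_nat => /eqP.
(* With radius [e / 2], two points close to the same [x] are less than [e] apart at all times up to
   [n], as [bowen_ball_count] requires. *)
pose c x y := [forall k : 'I_n.+1, `|iter k g x - iter k g y| < e / 2].
have [||//|x xs|t [ut ts tc st]] := @exists_net _ c (2 ^ n)%N s.
- by move=> x; apply/forallP => k; rewrite subrr normr0 divr_gt0.
- by move=> x y; apply: eq_forallb => k; rewrite distrC.
- rewrite -size_filter; apply: (bowen_ball_count L0 e0 gI glap d0).
  + by rewrite /d mulrC divfK // expf_neq0 // gt_eqF.
  + exact: filter_uniq.
  + by move=> y; rewrite mem_filter => /andP[_]; exact: sI.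
  + by move=> y z; rewrite !mem_filter => /andP[_ ys] /andP[_ zs]; exact: sd.
  + move=> k kn y z; rewrite !mem_filter => /andP[/forallP cy _] /andP[/forallP cz _].
    have := cy (Ordinal (kn : (k < n.+1)%N)); have := cz (Ordinal (kn : (k < n.+1)%N)).
    rewrite /= => hz hy; rewrite (le_lt_trans (ler_distD (iter k g x) _ _)) //.
    by rewrite (splitr e) ltrD // distrC.
exists t; split=> //.
- by move=> x /ts; exact: sI.
- move=> x y xt yt /(tc _ _ xt yt); rewrite negb_forall => /existsP[k].
  by rewrite -leNgt => h; exists k => //; rewrite -ltnS.
- rewrite (le_trans (ltW (truncnS_gt _))) // ler_nat (leq_trans _ st) //.
  by rewrite size_map size_iota.
Qed.

(** Pigeonhole: two points in the same cell of length [d] are less than [d] apart, so the integer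
    part of [x / d] determines [x]. *)
Lemma separated_seq_size (s : seq R) d : 0 < d -> uniq s ->
  {in s, forall x, 0 <= x <= 1} ->
  {in s &, forall x y, x != y -> d <= `|x - y|} ->
  (size s)%:R <= d^-1 + 1.
Proof.
move=> d0 us sI sd.
have dx x : x \in s -> 0 <= x / d by move=> /sI/andP[x0 _]; rewrite divr_ge0 // ltW.
pose q := [seq Num.truncn (x / d) | x <- s].
have uq : uniq q.
  rewrite map_inj_in_uniq // => x y xs ys xy; apply/eqP/negPn/negP => /(sd _ _ xs ys).
  rewrite leNgt => /negP[].
  have /andP[] := truncn_itv (dx x xs); have /andP[] := truncn_itv (dx y ys).
  rewrite xy -natr1 !ler_pdivlMr // !ltr_pdivrMr // !mulrDl mul1r => *.
  by rewrite ltr_norml; apply/andP; split; lra.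
have qN : {subset q <= iota 0 (Num.truncn d^-1).+1}.
  move=> _ /mapP[x xs ->]; rewrite mem_iota add0n ltnS /= le_truncn //.
  by have /andP[_ x1] := sI x xs; rewrite ler_piMl // invr_ge0 ltW.
rewrite -(size_map (fun x => Num.truncn (x / d))) -/q.
have := uniq_leq_size uq qN; rewrite size_iota -(ler_nat R) => /le_trans; apply.
by rewrite -natr1 lerD2r truncn_le // invr_ge0 ltW.
Qed.

End constant_slope.

(** * Entropy of a map of constant slope *)

Section entropy.
Context {R : realType}.
Local Notation I01 := (`[0, 1]%classic : set R).
Implicit Types (f : R -> R) (l e eps : R) (n m : nat).

Lemma limn_esup_le_near (u : (\bar R)^nat) (a : \bar R) :
  (\forall n \near \oo, u n <= a)%E -> (limn_esup u <= a)%E.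
Proof.
move=> ua; apply: le_trans (ereal_inf_lbound _) _.
  by exists [set n | u n <= a]%E; [exact: ua | reflexivity].
by apply: ge_ereal_sup => _ [n /= una <-].
Qed.

(** The lower bound on separated sets will be available only at times of the form [(n * m).+1], so a
    condition at arbitrarily large indices has to suffice. *)
Lemma limn_esup_ge_freq (u : (\bar R)^nat) (a : \bar R) :
  (forall N, exists2 n, (N <= n)%N & (a <= u n)%E) -> (a <= limn_esup u)%E.
Proof.
move=> ua; apply: le_ereal_inf_tmp => _ [V [N _ NV] <-].
have [n Nn aun] := ua N; apply: le_trans aun _.
by apply: ereal_sup_ubound; exists n => //; exact: NV.
Qed.

(** Two points closer than [eps / l ^+ n] stay within [eps] of each other up to time [n]: while
    their distance is below [e], one step multiplies it by at most [l]. So separated points are at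
    least [eps / l ^+ n] apart. *)
Lemma max_separated_le f l e eps n : 1 <= l -> 0 < eps -> eps <= e ->
  (forall x, 0 <= x <= 1 -> 0 <= f x <= 1) ->
  (forall x, 0 <= x <= 1 -> two_laps f l e x) ->
  (max_separated I01 f n eps <= (l ^+ n / eps + 1)%:E)%E.
Proof.
move=> l1 eps0 epse fI flap; have l0 : 0 < l by lra.
apply: ge_ereal_sup => _ [E [EI Esep] <-].
have {}EI : {in E, forall x, 0 <= x <= 1}.
  by move=> x xE; have := EI x xE; rewrite /= in_itv.
rewrite lee_fin.
have -> : l ^+ n / eps = (eps / l ^+ n)^-1 by rewrite invf_div.
apply: (@separated_seq_size R E); rewrite ?divr_gt0 ?exprn_gt0 ?fset_uniq //.
move=> x y xE yE /eqP xy; have [k kn] := Esep x y xE yE xy.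
rewrite ler_pdivrMr ?exprn_gt0 // leNgt => kxy; apply/negP => xyn; apply: kxy.
suff kP j : (j <= n)%N -> [/\ 0 <= iter j f x <= 1, 0 <= iter j f y <= 1 &
    `|iter j f x - iter j f y| <= l ^+ j * `|x - y|].
  have [_ _ h] := kP k (ltnW kn); apply: le_lt_trans h (le_lt_trans _ xyn).
  by rewrite mulrC ler_wpM2l // ler_weXn2l // ltnW.
elim: j => [|j IH] jn; first by rewrite expr0 mul1r !EI.
have [xI yI xyj] := IH (ltnW jn); split; [exact: fI|exact: fI|].
have xyje : `|iter j f y - iter j f x| < e.
  rewrite distrC; apply: le_lt_trans xyj (lt_le_trans _ epse).
  by apply: le_lt_trans xyn; rewrite mulrC ler_wpM2l // ler_weXn2l // ltnW.
have [z zP] := flap _ xI; rewrite /= exprS -mulrA.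
have [] := zP _ _ xI yI _ xyje; first by rewrite subrr normr0 (lt_le_trans eps0).
by move=> h _; apply: le_trans h _; rewrite ler_wpM2l // ltW.
Qed.

Lemma entropy_at_le f l e eps : 1 < l -> 0 < eps -> eps <= e ->
  (forall x, 0 <= x <= 1 -> 0 <= f x <= 1) ->
  (forall x, 0 <= x <= 1 -> two_laps f l e x) ->
  (entropy_at I01 f eps <= (ln l)%:E)%E.
Proof.
move=> l1 eps0 epse fI flap; have l0 : 0 < l by lra.
apply/lee_addgt0Pr => h h0; apply: limn_esup_le_near.
(* Since [l ^+ n >= 1], the count [l ^+ n / eps + 1] is at most [l ^+ n * (eps^-1 + 1)]; its
   logarithm exceeds [n * ln l] by at most [C], and [C / n] tends to 0. *)
pose C := ln (eps^-1 + 1).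
have C1 : 0 < eps^-1 + 1 by rewrite addr_gt0 // invr_gt0.
near=> n.
have n0 : (0 < n)%N by near: n; exact: nbhs_infty_gt.
have n0R : 0 < n%:R :> R by rewrite ltr0n.
have Cn : C <= n%:R * h.
  by rewrite -ler_pdivrMr //; near: n; exact: nbhs_infty_ger.
have ln1 : 1 <= l ^+ n by rewrite exprn_ege1 // ltW.
have up : (lne (max_separated I01 f n eps) <= (n%:R * ln l + C)%:E)%E.
  have [neg|pos] := leP (max_separated I01 f n eps) 0%E.
    by rewrite le0_lneNy // leNye.
  have -> : n%:R * ln l + C = ln (l ^+ n * (eps^-1 + 1)).
    by rewrite lnM ?posrE ?exprn_gt0 // lnXn // mulr_natl.
  rewrite -lne_EFin ?mulr_gt0 ?exprn_gt0 // lee_lne.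
  - apply: le_trans (max_separated_le n (ltW l1) eps0 epse fI flap) _.
    by rewrite lee_fin mulrDr mulr1 lerD2l.
  - by rewrite in_itv /= ltW //= leey.
  - by rewrite in_itv /= lee_fin leey andbT mulr_ge0 ?exprn_ge0 ?ltW.
apply: (@le_trans _ _ ((n%:R^-1)%:E * (n%:R * ln l + C)%:E)%E).
  by rewrite lee_wpmul2l // lee_fin invr_ge0 ltW.
rewrite -EFinM -EFinD lee_fin mulrC ler_pdivrMr // mulrDl mulrC lerD2l.
by rewrite mulrC.
Unshelve. all: by end_near.
Qed.

(** A separation time [k <= n] for the [m]-th iterate is the time [k * m] for [f]; [separated]
    counts times strictly below its index, hence the successor. *)
Lemma max_separated_ge f l e eps m n : 0 < l -> 0 < e -> eps <= e / 2 ->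
  (forall x, 0 <= x <= 1 -> 0 <= iter m f x <= 1) ->
  (forall x, 0 <= x <= 1 -> two_laps (iter m f) (l ^+ m) e x) ->
  ((l ^+ (n * m) / (2 ^+ n * e))%:E <=
    max_separated I01 f (n * m).+1 eps)%E.
Proof.
move=> l0 e0 epse gI glap.
have [t [ut tI tsep tn]] := separated_seq n (exprn_gt0 m l0) e0 gI glap.
apply: (@le_trans _ _ (size t)%:R%:E).
  rewrite lee_fin invfM mulrCA ler_pdivrMl ?exprn_gt0 //.
  by rewrite mulnC exprM -natrX -natrM.
apply: ereal_sup_ubound; exists [fset x in t]%fset; last first.
  by rewrite card_fseq undup_id.
split.
  by move=> x /=; rewrite in_itv /= inE => /tI.
move=> x y /=; rewrite !inE => xt yt /eqP xy.
have [k kn kxy] := tsep x y xt yt xy; exists (k * m)%N.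
  by rewrite ltnS leq_mul2r kn orbT.
rewrite !iterM /ball /= ltNge; apply/negP/negPn.
exact: le_trans epse kxy.
Qed.

Lemma entropy_at_ge f l e eps m : (0 < m)%N -> 0 < l -> 0 < e -> eps <= e / 2 ->
  (forall x, 0 <= x <= 1 -> 0 <= iter m f x <= 1) ->
  (forall x, 0 <= x <= 1 -> two_laps (iter m f) (l ^+ m) e x) ->
  ((ln l - ln 2 / m%:R)%:E <= entropy_at I01 f eps)%E.
Proof.
move=> m0 l0 e0 epse gI glap; have m0R : 0 < m%:R :> R by rewrite ltr0n.
apply/lee_subgt0Pr => h h0; rewrite -EFinB; apply: limn_esup_ge_freq => N.
(* With [M = n * m], the logarithm of the count is at least [M * c - ln e]. Dividing by [M + 1]
   leaves at least [c - h] exactly when [B <= M * h], which dictates [n]. *)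
set c := ln l - _; pose B := c - h + ln e.
pose n := maxn N (Num.truncn (`|B| / h)).+1.
have nB : B <= n%:R * m%:R * h.
  apply: le_trans (ler_norm B) _; rewrite -ler_pdivrMr //.
  apply: le_trans (ltW (truncnS_gt _)) _.
  by rewrite -natrM ler_nat; apply: leq_trans (leq_pmulr _ m0); rewrite leq_maxr.
exists (n * m).+1.
  by apply: leqW; apply: (@leq_trans n); [exact: leq_maxl | exact: leq_pmulr].
have M0 : 0 < (n * m).+1%:R :> R by rewrite ltr0n.
have q0 : 0 < l ^+ (n * m) / (2 ^+ n * e).
  by rewrite divr_gt0 ?mulr_gt0 ?exprn_gt0.
have msg := max_separated_ge n l0 e0 epse gI glap.
apply: (@le_trans _ _ (((n * m).+1%:R^-1)%:E *
    (ln (l ^+ (n * m) / (2 ^+ n * e)))%:E)%E); last first.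
  apply: lee_wpmul2l; first by rewrite lee_fin invr_ge0 ltW.
  rewrite -lne_EFin // lee_lne //; rewrite in_itv /= leey andbT ?lee_fin ?ltW //.
  by apply: lt_le_trans msg; rewrite lte_fin.
rewrite -EFinM lee_fin mulrC ler_pdivlMr //.
rewrite ln_div ?posrE ?mulr_gt0 ?exprn_gt0 // lnM ?posrE ?exprn_gt0 //.
rewrite !lnXn // -(mulr_natl (ln l)) -(mulr_natl (ln 2)) -(natr1 (n * m)%N) natrM.
have cE : m%:R * c = m%:R * ln l - ln 2.
  by rewrite /c mulrBr (mulrC m%:R (_ / _)) divfK // gt_eqF.
have -> : n%:R * m%:R * ln l - (n%:R * ln 2 + ln e) = n%:R * (m%:R * c) - ln e.
  by rewrite cE; ring.
have slack (u v w z : R) : w - h + z <= u * v * h ->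
  (w - h) * (u * v + 1) <= u * (v * w) - z by clear; lra.
exact: slack nB.
Qed.

Theorem entropy_constant_slope f l : 1 < l ->
  (forall x, 0 <= x <= 1 -> 0 <= f x <= 1) ->
  (forall x, 0 <= x <= 1 -> affine_sides f l x) ->
  topological_entropy I01 f = (ln l)%:E.
Proof.
move=> l1 fI fl; have l0 : 0 < l by lra.
have [e0 e00 flap] := two_laps_unif (ltW l0) fl.
have ub : \forall eps \near (0 : R)^'+,
    (entropy_at I01 f eps <= (ln l)%:E)%E.
  near=> eps; apply: (@entropy_at_le _ _ e0) => //.
  by near: eps; exact: nbhs_right_le.
have lb (h : R) : 0 < h -> \forall eps \near (0 : R)^'+,
    ((ln l - h)%:E <= entropy_at I01 f eps)%E.
  (* This [m] exceeds [ln 2 / h], so the loss [ln 2 / m] is at most [h]. The scale [e] found below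
     depends on [m], hence on [h]. *)
  move=> h0; pose m := (Num.truncn (ln 2 / h)).+1.
  have gI x (xI : 0 <= x <= 1) := (affine_sides_iter l0 fI fl m xI).1.
  have gl x (xI : 0 <= x <= 1) := (affine_sides_iter l0 fI fl m xI).2.
  have [e e1 glap] := two_laps_unif (exprn_ge0 m (ltW l0)) gl.
  near=> eps.
  apply: (@le_trans _ _ (ln l - ln 2 / m%:R)%:E); last first.
    apply: (@entropy_at_ge _ _ e) => //.
    by near: eps; apply: nbhs_right_le; rewrite divr_gt0.
  rewrite lee_fin lerD2l lerN2 ler_pdivrMr ?ltr0n // mulrC -ler_pdivrMr //.
  exact: ltW (truncnS_gt _).
apply/cvg_lim => //; apply/fine_cvgP; split.
  (* The values are eventually finite: [ub] bounds them above, and [lb] with [h = 1] below. *)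
  near=> eps; apply/fin_real/andP; split.
    apply: (@lt_le_trans _ _ (ln l - 1)%:E); first exact: ltNyr.
    by near: eps; exact: lb.
  apply: (@le_lt_trans _ _ (ln l)%:E); last exact: ltry.
  by near: eps.
apply/cvgrPdist_le => h h0; near=> eps => /=.
have u : (entropy_at I01 f eps <= (ln l)%:E)%E by near: eps.
have : ((ln l - h)%:E <= entropy_at I01 f eps)%E.
  by near: eps; exact: lb.
move: u; case: (entropy_at _ _ _) => [r| |] //=; rewrite !lee_fin => u v.
by rewrite ger0_norm; lra.
Unshelve. all: by end_near.
Qed.

End entropy.

(** * The given map has slope [l] or [- l] on each side of every point *)

Section the_map_slope.
Context {R : realType}.
Implicit Types (g : R -> R) (L a b x y : R).

(** At 0 and 1 the outward side contains only [u = 0], where the formula is trivial, so one-sided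
    data are asked for only towards the inside. *)
Lemma affine_sidesI g L x :
  (x < 1 -> exists (b : R) (c : bool), x < b /\
    forall y, x <= y <= b -> g y = g x + (-1) ^+ c * (L * (y - x))) ->
  (0 < x -> exists (a : R) (c : bool), a < x /\
    forall y, a <= y <= x -> g y = g x + (-1) ^+ c * (L * (x - y))) ->
  0 <= x <= 1 -> affine_sides g L x.
Proof.
move=> right left /andP[x0 x1]; case; rewrite ?expr1 ?expr0.
  case: (ltP 0 x) => [/left[a [c [ax aE]]]|x0'].
    exists (x - a); first by rewrite subr_gt0.
    exists c => u /andP[u0 ua] _; rewrite aE; last by apply/andP; split; lra.
    by congr (_ + _ * (_ * _)); ring.
  exists 1 => //; exists false => u /andP[u0 _] /andP[xu _].
  have -> : u = 0 by lra.
  by rewrite !mulr0 !addr0.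
case: (ltP x 1) => [/right[b [c [xb bE]]]|x1'].
  exists (b - x); first by rewrite subr_gt0.
  exists c => u /andP[u0 ub] _; rewrite bE; last by apply/andP; split; lra.
  by congr (_ + _ * (_ * _)); ring.
exists 1 => //; exists false => u /andP[u0 _] /andP[_ xu].
have -> : u = 0 by lra.
by rewrite !mulr0 !addr0.
Qed.

(** The half containing [x] decides the sign. At the midpoint the graph falls to the right, so the
    peak is counted with the right half here and with the left half in [tent_left]. *)
Lemma tent_right g L a b x : a <= x -> x < b ->
  (forall y, a <= y <= b -> g y = tent L a b y) ->
  exists (b' : R) (c : bool), x < b' /\
    forall y, x <= y <= b' -> g y = g x + (-1) ^+ c * (L * (y - x)).
Proof.
move=> ax xb gE; case: (ltP x ((a + b) / 2)) => xm.
  exists ((a + b) / 2), false; split=> // y /andP[xy ym].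
  rewrite !gE; [|apply/andP; split; lra..].
  by rewrite /tent !min_l; [ring|lra..].
exists b, true; split=> // y /andP[xy ym].
rewrite !gE; [|apply/andP; split; lra..].
by rewrite /tent !min_r ?expr1; [ring|lra..].
Qed.

Lemma tent_left g L a b x : a < x -> x <= b ->
  (forall y, a <= y <= b -> g y = tent L a b y) ->
  exists (a' : R) (c : bool), a' < x /\
    forall y, a' <= y <= x -> g y = g x + (-1) ^+ c * (L * (x - y)).
Proof.
move=> ax xb gE; case: (ltP ((a + b) / 2) x) => xm.
  exists ((a + b) / 2), false; split=> // y /andP[xy ym].
  rewrite !gE; [|apply/andP; split; lra..].
  by rewrite /tent !min_r; [ring|lra..].
exists a, true; split=> // y /andP[xy ym].
rewrite !gE; [|apply/andP; split; lra..].
by rewrite /tent !min_l ?expr1; [ring|lra..].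
Qed.

Section fixed_parameters.
Variables (p : nat) (l : R).
Hypotheses (hp : (3 <= p)%N) (podd : odd p) (hl : lambda_ p <= l).

(** Descend from the last interval to the first one whose left end is at most [x]. Asking for
    [x < b] leaves room to the right of [x] and excludes a degenerate last interval. *)
Lemma f_pl_right_tent x : l^-1 <= x -> x < tpt p l ->
  exists a b : R, [/\ a <= x, x < b &
    forall y, a <= y <= b -> f_pl p l y = tent l a b y].
Proof.
move=> lx xt; have lt := le_lt_trans lx xt.
case: (leP (Jend p l (num_full p l)) x) => [kx|].
  by exists (Jend p l (num_full p l)), (tpt p l); split=> // y; exact: f_pl_K.
move: (leqnn (num_full p l)); move: {1 3}(num_full p l) => i.
elim: i => [|j IH] jk; first by rewrite Jend0 ltNge lx.
move=> xj; case: (leP (Jend p l j) x) => [jx|/IH]; last by apply; exact: ltnW.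
by exists (Jend p l j), (Jend p l j.+1); split=> // y; exact: f_pl_J.
Qed.

(** The same descent with the strict inequality on the left: at a common endpoint of two tents it
    selects the one before [x]. *)
Lemma f_pl_left_tent x : l^-1 < x -> x <= tpt p l ->
  exists a b : R, [/\ a < x, x <= b &
    forall y, a <= y <= b -> f_pl p l y = tent l a b y].
Proof.
move=> lx xt; have lt := lt_le_trans lx xt.
case: (ltP (Jend p l (num_full p l)) x) => [kx|].
  by exists (Jend p l (num_full p l)), (tpt p l); split=> // y; exact: f_pl_K.
move: (leqnn (num_full p l)); move: {1 3}(num_full p l) => i.
elim: i => [|j IH] jk; first by rewrite Jend0 leNgt lx.
move=> xj; case: (ltP (Jend p l j) x) => [jx|/IH]; last by apply; exact: ltnW.
by exists (Jend p l j), (Jend p l j.+1); split=> // y; exact: f_pl_J.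
Qed.

Lemma f_pl_affine_sides x : 0 <= x <= 1 -> affine_sides (f_pl p l) l x.
Proof.
have lt : l^-1 <= tpt p l by have /andP[] := tpt_itv hp podd hl.
(* A breakpoint is assigned to the branch on the side under study. If [tpt p l] equals [l^-1], the
   middle case is empty and the two outer branches meet there. *)
apply: affine_sidesI => [x1|x0].
  case: (ltP x l^-1) => [xl|lx].
    exists l^-1, true; split=> // y /andP[xy yl].
    by rewrite !f_pl_left ?(ltW xl) // expr1; ring.
  case: (ltP x (tpt p l)) => [xt|tx].
    have [a [b [ax xb]]] := f_pl_right_tent lx xt; exact: tent_right.
  exists 1, false; split=> // y /andP[xy _].
  by rewrite !f_pl_right ?(le_trans tx) // expr0; ring.
case: (leP x l^-1) => [xl|lx].
  exists 0, false; split=> // y /andP[_ yx].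
  by rewrite !f_pl_left ?(le_trans yx) // expr0; ring.
case: (leP x (tpt p l)) => [xt|tx].
  have [a [b [ax xb]]] := f_pl_left_tent lx xt; exact: tent_left.
exists (tpt p l), true; split=> // y /andP[ty _].
by rewrite !f_pl_right ?(ltW tx) // expr1; ring.
Qed.

End fixed_parameters.
End the_map_slope.

Theorem corollary3p4 (R : realType) (p : nat) (l : R)
    (hp : (3 <= p)%N) (podd : odd p) (hl : lambda_ p <= l) :
  topological_entropy (`[0, 1]%classic : set R) (f_pl p l) = (ln l)%:E.
Proof.
apply: entropy_constant_slope; first exact: lambda_gt1 hp hl.
  by move=> x; exact: f_pl_itv.
by move=> x; exact: f_pl_affine_sides.
Qed.
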